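(* Let $p\geq 7$ be a prime number and let $b(12p)$ denote the number of isomorphism classes of left braces of size $12p$. Then $$b(12p)=\begin{cases}24 & \text{if } p\equiv 11 \pmod{12},\\ 28 & \text{if } p\equiv 5 \pmod{12},\\ 34 & \text{if } p\equiv 7 \pmod{12},\\ 40 & \text{if } p\equiv 1 \pmod{12}.\end{cases}$$
   Context: A left brace is a set $B$ with two operations $+$ and $\cdot$ such that $(B,+)$ is an abelian group, $(B,\cdot)$ is a group, and $a(b+c)=ab-a+ac$ for all $a,b,c\in B$. Two left braces are isomorphic if there is a bijection between them preserving both operations. *)

(* Defs.v *)
(* MathComp; [boolp] only supplies the classical boolean reflection [`[< P >]]. *)
From mathcomp Require Import boolp.
From mathcomp Require Import all_boot.

Set Implicit Arguments.
Unset Strict Implicit.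
Unset Printing Implicit Defensive.

Definition is_group (T : Type) (op : T -> T -> T) (e : T) (inv : T -> T) : Prop :=
  [/\ associative op, left_id e op, right_id e op,
      left_inverse e inv op & right_inverse e inv op].

Definition is_left_brace (T : Type) (add mul : T -> T -> T) : Prop :=
  exists (zero : T) (opp : T -> T) (one : T) (inv : T -> T),
    [/\ is_group add zero opp, commutative add, is_group mul one inv
      & forall a b c,
          mul a (add b c) = add (add (mul a b) (opp a)) (mul a c)].

Definition brace_isomorphic (T U : Type)
    (addT mulT : T -> T -> T) (addU mulU : U -> U -> U) : Prop :=
  exists f : T -> U,
    [/\ bijective f, {morph f : x y / addT x y >-> addU x y}
      & {morph f : x y / mulT x y >-> mulU x y}].

(* A pair of operation tables (addition, multiplication) on ['I_n]. *)
Definition tables (n : nat) : finType :=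
  ({ffun 'I_n * 'I_n -> 'I_n} * {ffun 'I_n * 'I_n -> 'I_n})%type.

Definition tadd (n : nat) (B : tables n) (x y : 'I_n) : 'I_n := B.1 (x, y).
Definition tmul (n : nat) (B : tables n) (x y : 'I_n) : 'I_n := B.2 (x, y).

Definition left_braces (n : nat) : {set tables n} :=
  [set B : tables n | `[< is_left_brace (tadd B) (tmul B) >]].

Definition isomorphic_tables (n : nat) : rel (tables n) :=
  fun B C => `[< brace_isomorphic (tadd B) (tmul B) (tadd C) (tmul C) >].

(* The number of isomorphism classes of left braces of size n. Working with
   the carrier ['I_n] loses nothing, by [left_brace_on_ord] below. *)
Definition num_left_braces (n : nat) : nat :=
  #|equivalence_partition (@isomorphic_tables n) (left_braces n)|.

Lemma isomorphic_tables_equiv (n : nat) :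
  {in left_braces n & &, equivalence_rel (@isomorphic_tables n)}.
Proof.
have symm (B C : tables n) : isomorphic_tables B C -> isomorphic_tables C B.
  move=> /asboolP[f [[g fK gK] fD fM]]; apply/asboolP; exists g.
  split; first by exists f.
    by move=> x y; rewrite -{1}[x]gK -{1}[y]gK -fD fK.
  by move=> x y; rewrite -{1}[x]gK -{1}[y]gK -fM fK.
have trans (B C D : tables n) :
    isomorphic_tables B C -> isomorphic_tables C D -> isomorphic_tables B D.
  move=> /asboolP[f [fb fD fM]] /asboolP[g [gb gD gM]]; apply/asboolP.
  exists (g \o f); split; first exact: bij_comp.
    by move=> x y /=; rewrite fD gD.
  by move=> x y /=; rewrite fM gM.
move=> B C D _ _ _; split.
  by apply/asboolP; exists id; split=> //; exists id.
move=> BC; apply/idP/idP ; last exact: trans.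
by apply: trans; apply: symm.
Qed.

Lemma left_brace_on_ord (n : nat) (T : finType) (add mul : T -> T -> T) :
    #|T| = n -> is_left_brace add mul ->
  exists2 B, B \in left_braces n & brace_isomorphic add mul (tadd B) (tmul B).
Proof.
move=> cT [z [o [e [i [[Aa Al Ar Avl Avr] Ac [Ma Ml Mr Mvl Mvr] br]]]]].
subst n; pose f := @enum_rank T; pose g := @enum_val T T.
have fK : cancel f g by exact: enum_rankK.
have gK : cancel g f by exact: enum_valK.
pose tr (op : T -> T -> T) := [ffun u => f (op (g u.1) (g u.2))].
exists (tr add, tr mul); last first.
  exists f; split; first by exists g.
    by move=> x y; rewrite /tadd ffunE /= !fK.
  by move=> x y; rewrite /tmul ffunE /= !fK.
rewrite inE; apply/asboolP.
exists (f z), (f \o o \o g), (f e), (f \o i \o g).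
split; [split | | split |] => [x y t|x|x|x|x|x y|x y t|x|x|x|x|x y t];
  rewrite /tadd /tmul !ffunE /= ?fK ?gK.
- by rewrite Aa.
- by rewrite Al gK.
- by rewrite Ar gK.
- by rewrite Avl.
- by rewrite Avr.
- by rewrite Ac.
- by rewrite Ma.
- by rewrite Ml gK.
- by rewrite Mr gK.
- by rewrite Mvl.
- by rewrite Mvr.
- by rewrite br.
Qed.

(* Main.v *)
Require Import Defs.
From mathcomp Require Import boolp.
From mathcomp Require Import all_boot.
From HB Require Import structures.
From mathcomp Require Import all_fingroup all_algebra cyclic pgroup sylow finfield.

Set Implicit Arguments.
Unset Strict Implicit.
Unset Printing Implicit Defensive.
Import GRing.Theory.

(** The additive group of a left brace of size 12p splits as S x T x P, with
    S of order 4 (the cyclic group or the Klein group), T = F_3 and P = F_p.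
    Write a b = a + lam_a(b); the brace axiom says that lam_a is an additive
    automorphism, and associativity that a |-> lam_a is a homomorphism from
    the multiplicative group.  Automorphisms preserve the three summands, which
    are characteristic, so lam_a is a triple (u, v, w) of an automorphism u of S,
    a sign v acting on F_3, and a scalar w of F_p ([additive_split]).

    The scalar w is trivial on P: for z in P it satisfies the twisted equation
    w(x + w(x) y) = w(x) w(y), and if w(x) were not 1, the affine map
    y |-> x + w(x) y would have a fixed point y, whence w(y) = w(x) w(y)
    ([twisted_character_trivial]).  So multiplication on P is addition, and u, v
    are homomorphisms from (F_p, +) to groups of exponent dividing 12, hence
    trivial.  In the same way v is trivial on T.  Since every element of the
    brace is a product of an element of P, one of S and one of T, the brace is
    determined by the values of (u, v, w) on S and at the generator of T.
    These w are 4th resp. 3rd roots of unity in F_p, so with a primitive g-th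
    root of unity zeta of F_p, where g = gcd(12, p - 1), they are given by
    exponents modulo g.  A brace thus becomes a code, a piece of finite data
    which depends on p only through g, and the codes that occur are those which
    pass a finite test ([brace_code], [model_brace]).

    An isomorphism of two such braces is again a triple of automorphisms of S,
    F_3 and F_p; its scalar on F_p commutes with everything, and what
    remains is a finite condition on the two codes ([model_isoP]).  Hence the
    number of isomorphism classes is the number of orbits in a finite list
    of codes, which is evaluated for g = 2, 4, 6, 12 ([num_left_braces_reps]).

    For orientation, the orbits are as follows.  If T acts trivially on S, then
    S is one of the four braces of order 4, together with characters v : S -> {1, -1}
    and w : S -> F_p^* up to Aut S, and, if v = 1 and 3 divides p - 1, possibly a
    nontrivial w on T, which is unique up to Aut T.  The four braces S
    contribute 4 + 10 + 5 + 4 = 23 pairs (v, w) if p = 3 mod 4 and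
    6 + 10 + 5 + 6 = 27 if p = 1 mod 4; with v = 1 they contribute
    2 + 3 + 2 + 2 = 9, resp. 3 + 3 + 2 + 3 = 11.  If T acts nontrivially on S,
    the multiplicative group of the 12-part is A_4, and there is one class, or
    two if 3 divides p - 1.  The totals are 23 + 1, 27 + 1, 23 + 9 + 2 and
    27 + 11 + 2. *)

(** * Finite encoding of the braces *)

Definition quad : Type := (bool * bool)%type.
Definition q0 : quad := (false, false).
Definition quads : seq quad :=
  [:: (false, false); (true, false); (false, true); (true, true)].

(** For k = true the carry makes this the cyclic group of order 4, the pair (a, b)
    being a + 2b; for k = false it is the Klein group. *)
Definition qadd (k : bool) (x y : quad) : quad :=
  (x.1 (+) y.1, (x.2 (+) y.2) (+) [&& k, x.1 & y.1]).
Definition qopp (k : bool) (x : quad) : quad := (x.1, x.2 (+) (k && x.1)).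

(** A function on [quad] with a known value at [q0], stored by its three other
    values so that it is first-order data with decidable equality. *)
Definition tab (X : Type) : Type := (X * X * X)%type.
Definition look X (x0 : X) (f : tab X) (s : quad) : X :=
  match s with
  | (false, false) => x0
  | (true, false) => f.1.1
  | (false, true) => f.1.2
  | (true, true) => f.2
  end.
Definition tabulate X (F : quad -> X) : tab X :=
  (F (true, false), F (false, true), F (true, true)).
Definition tabs (X : Type) (l : seq X) : seq (tab X) :=
  [seq (ab, c) | ab <- [seq (a, b) | a <- l, b <- l], c <- l].

Definition appe : tab quad -> quad -> quad := look q0.
Definition ide : tab quad := tabulate id.
Definition compe (e f : tab quad) : tab quad :=
  tabulate (fun s => appe e (appe f s)).

Definition is_qiso (k k' : bool) (e : tab quad) : bool :=
  uniq [seq appe e x | x <- quads] && all (fun x => all (fun y =>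
       appe e (qadd k x y) == qadd k' (appe e x) (appe e y)) quads) quads.

(** Empty unless k = k', so that codes of different kinds are not equivalent
    under [equivc] below. *)
Definition qisos (k k' : bool) : seq (tab quad) :=
  [seq e <- tabs quads | is_qiso k k' e].

(** The components are: the kind of the additive group S; the action u of S on S,
    the action v of S on F_3 (true meaning the sign -1) and the exponent w of the
    action of S on F_p; the action of 1 in F_3 on S, and the exponent of its
    action on F_p. *)
Definition code : Type :=
  (bool * tab (tab quad) * tab bool * tab nat * tab quad * nat)%type.
Definition c_cyc (c : code) : bool := c.1.1.1.1.1.
Definition c_u (c : code) := look ide c.1.1.1.1.2.
Definition c_v (c : code) := look false c.1.1.1.2.
Definition c_w (c : code) := look 0 c.1.1.2.
Definition c_ut (c : code) := c.1.2.
Definition c_wt (c : code) := c.2.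

Arguments c_u : simpl never.
Arguments c_v : simpl never.
Arguments c_w : simpl never.

(** The sign (-1)^b on F_3, for the representatives 0, 1, 2; in [lamS] the result
    is a number of iterations. *)
Definition sgn3 (b : bool) (t : nat) : nat := if b then (3 - t) %% 3 else t.

(** The action of (s, t) in S x F_3.  As (s, 0) (0, t') = (s, v(s) t') and v(s) is
    a sign, (s, t) = (s, 0) (0, v(s) t), which explains the sign on t. *)
Definition lamS (c : code) (s : quad) (t : nat) : tab quad :=
  compe (c_u c s) (iter (sgn3 (c_v c s) t) (compe (c_ut c)) ide).
Definition lamP (c : code) (s : quad) (t : nat) : nat :=
  c_w c s + sgn3 (c_v c s) t * c_wt c.

Definition ST : seq (quad * nat) := [seq (s, t) | s <- quads, t <- [:: 0; 1; 2]].
Definition mulST (c : code) (a b : quad * nat) : quad * nat :=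
  (qadd (c_cyc c) a.1 (appe (lamS c a.1 a.2) b.1),
   (a.2 + sgn3 (c_v c a.1) b.2) %% 3).

(** This tests that (s, t) |-> lam is a homomorphism into the automorphisms. *)
Definition admissible (g : nat) (c : code) : bool :=
  all (fun a => is_qiso (c_cyc c) (c_cyc c) (lamS c a.1 a.2) &&
    all (fun b => let ab := mulST c a b in
    [&& lamS c ab.1 ab.2 == compe (lamS c a.1 a.2) (lamS c b.1 b.2),
        c_v c ab.1 == c_v c a.1 (+) c_v c b.1
      & lamP c ab.1 ab.2 == lamP c a.1 a.2 + lamP c b.1 b.2 %[mod g]]) ST) ST.

(** An isomorphism between the braces with codes c and d acts on S by some e and
    on F_3 by a sign b; it carries the action of a to the action of its image. *)
Definition equivc (g : nat) (c d : code) : bool :=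
  has (fun e => has (fun b => all (fun a =>
     let a' := (appe e a.1, sgn3 b a.2) in
     [&& compe e (lamS c a.1 a.2) == compe (lamS d a'.1 a'.2) e,
         c_v c a.1 == c_v d a'.1
       & lamP c a.1 a.2 == lamP d a'.1 a'.2 %[mod g]]) ST) [:: false; true])
  (qisos (c_cyc c) (c_cyc d)).

(** The homomorphism condition for the multiplication x y = x + u(x)(y) on S. *)
Definition homS (X : eqType) (x1 : X) (op : X -> X -> X) k u (f : tab X) : bool :=
  all (fun x => all (fun y =>
    look x1 f (qadd k x (appe (look ide u x) y))
      == op (look x1 f x) (look x1 f y)) quads) quads.

Definition torsion (g n : nat) : seq nat := [seq i <- iota 0 g | g %| n * i].

Definition admissible_u (k : bool) : seq (tab (tab quad)) :=
  [seq u <- tabs (qisos k k) | homS ide compe k u u].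
Definition admissible_v k u : seq (tab bool) :=
  [seq v <- tabs [:: false; true] | homS false addb k u v].
Definition admissible_w g k u : seq (tab nat) :=
  [seq w <- tabs (torsion g 4) | homS 0 (fun i j => (i + j) %% g) k u w].
Definition admissible_ut k : seq (tab quad) :=
  [seq e <- qisos k k | compe e (compe e e) == ide].

(** Imposing the constraints that concern S or F_3 alone before the full test
    keeps the enumeration small. *)
Definition codes (g : nat) : seq code :=
  [seq c <- flatten [seq flatten [seq
      [seq (k, u, vw.1, vw.2, y.1, y.2) |
         vw <- [seq (v, w) | v <- admissible_v k u, w <- admissible_w g k u],
         y <- [seq (ut, wt) | ut <- admissible_ut k, wt <- torsion g 3]]
      | u <- admissible_u k]
    | k <- [:: false; true]]
  | admissible g c].

(** One representative for each class of an equivalence relation e, in the form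
    that evaluates directly. *)
Fixpoint greedy (T : Type) (e : rel T) (s : seq T) : seq T :=
  if s is x :: s' then
    let r := greedy e s' in if has (e x) r then r else x :: r
  else [::].

Lemma greedy_sub (T : eqType) (e : rel T) (s : seq T) : {subset greedy e s <= s}.
Proof.
elim: s => //= x s IH y; case: ifP => _; rewrite !inE; first by move/IH ->; rewrite orbT.
by case/orP=> [->|/IH ->] //; rewrite orbT.
Qed.

Lemma greedy_pairwise (T : Type) (e : rel T) (s : seq T) :
  pairwise (fun x y => ~~ e x y) (greedy e s).
Proof. by elim: s => //= x s IH; case: ifP => //= /negbT; rewrite -all_predC => ->. Qed.

Lemma greedy_cover (T : eqType) (e : rel T) (s : seq T) :
  {in s, forall x, exists2 y, y \in greedy e s & (x == y) || e x y}.
Proof.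
elim: s => //= x s IH y; rewrite inE => /orP[/eqP ->|/IH[z zr yz]]; last first.
  by exists z; rewrite //; case: ifP => _ //; rewrite inE zr orbT.
case: ifP => [/hasP[z zr xz]|_]; first by exists z; rewrite // xz orbT.
by exists x; rewrite ?eqxx ?mem_head.
Qed.

Definition reps (g : nat) : seq code := greedy (equivc g) (codes g).

(** * The additive group and its automorphisms *)

(** The group structure on [quad] depends on k, hence an alias for each k. *)
Definition quadgrp (k : bool) : Type := quad.
HB.instance Definition _ (k : bool) := Finite.copy (quadgrp k) quad.

Lemma qaddA k : associative (qadd k).
Proof. by case: k => -[[] []] [[] []] [[] []]. Qed.

Lemma qaddC k : commutative (qadd k).
Proof. by case: k => -[[] []] [[] []]. Qed.

Lemma qadd0 k : left_id q0 (qadd k).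
Proof. by case: k => -[[] []]. Qed.

Lemma qaddN k : left_inverse q0 (qopp k) (qadd k).
Proof. by case: k => -[[] []]. Qed.

HB.instance Definition _ (k : bool) :=
  GRing.isZmodule.Build (quadgrp k) (@qaddA k) (@qaddC k) (@qadd0 k) (@qaddN k).

Lemma tab_ext (e f : tab quad) : appe e =1 appe f -> e = f.
Proof.
case: e f => [[a b] c] [[a' b'] c'] E.
by move: (E (true, false)) (E (false, true)) (E (true, true)); rewrite /appe /= => -> -> ->.
Qed.

Lemma look_tabulate X (x0 : X) F s : F q0 = x0 -> look x0 (tabulate F) s = F s.
Proof. by case: s => -[] [] <-. Qed.

Lemma appe_comp e f s : appe (compe e f) s = appe e (appe f s).
Proof. exact: look_tabulate. Qed.

Lemma mem_tabs (X : eqType) (l : seq X) a b c :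
  a \in l -> b \in l -> c \in l -> (a, b, c) \in tabs l.
Proof. by move=> al bl cl; rewrite /tabs allpairs_f // allpairs_f. Qed.

Lemma mem_tabs_tabulate (X : eqType) (l : seq X) F :
  (forall s, F s \in l) -> tabulate F \in tabs l.
Proof. by move=> Fl; apply: mem_tabs. Qed.

Lemma mem_quads (s : quad) : s \in quads.
Proof. by case: s => -[] []. Qed.

Lemma qisosP k k' e :
  reflect (injective (appe e) /\ {morph appe e : x y / qadd k x y >-> qadd k' x y})
          (e \in qisos k k').
Proof.
have -> : (e \in qisos k k') = is_qiso k k' e.
  rewrite mem_filter; case: e => [[a b] c].
  by rewrite mem_tabs ?mem_quads // andbT.
have inE : uniq [seq appe e x | x <- quads] <-> injective (appe e).
  split=> [U x y E|I]; last by rewrite map_inj_uniq.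
  have ix := mem_quads x; have iy := mem_quads y.
  rewrite -[x](nth_index q0 ix) -[y](nth_index q0 iy).
  congr nth; apply/eqP.
  rewrite -(nth_uniq q0 _ _ U) ?size_map ?index_mem //.
  by rewrite !(nth_map q0) ?index_mem // !nth_index // E.
apply: (iffP andP) => -[/inE I M]; split=> //.
  by move=> x y; apply/eqP; apply: (allP (allP M x (mem_quads _)) y (mem_quads _)).
by apply/allP=> x _; apply/allP=> y _; rewrite M.
Qed.

Notation carrier p k := (quadgrp k * 'F_3 * 'F_p)%type.

Lemma carrier_eq p k (a b : carrier p k) :
  a.1.1 = b.1.1 -> a.1.2 = b.1.2 -> a.2 = b.2 -> a = b.
Proof. by case: a b => [[? ?] ?] [[? ?] ?] /= -> -> ->. Qed.

Section Additive.
Local Open Scope ring_scope.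
Variable p : nat.
Hypotheses (p_pr : prime p) (p_ge7 : (7 <= p)%N).

Lemma F3_cases (t : 'F_3) : [\/ t = 0, t = 1 | t = 1 + 1].
Proof.
case: t => -[|[|[|//]]] lt3; [constructor 1 | constructor 2 | constructor 3];
  exact: val_inj.
Qed.

Lemma quad_mul4 k (s : quadgrp k) : s *+ 4 = 0.
Proof. by case: k s => -[[] []]. Qed.

Lemma F3_mul3 (t : 'F_3) : t *+ 3 = 0.
Proof. by case: (F3_cases t) => ->; apply: val_inj. Qed.

Lemma Fp_n_neq0 n : (0 < n)%N -> (n < p)%N -> n%:R != 0 :> 'F_p.
Proof.
move=> n0 np; rewrite -(dvdn_pcharf (pchar_Fp p_pr)).
by apply: contraTN np => /dvdn_leq -/(_ n0); rewrite leqNgt.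
Qed.

Lemma Fp12_neq0 : 12%:R != 0 :> 'F_p.
Proof.
rewrite (_ : 12 = 3 * 4)%N // natrM mulf_neq0 //;
  apply: Fp_n_neq0 => //; exact: leq_trans p_ge7.
Qed.

Lemma Fp_div12 (z : 'F_p) : exists y, z = y *+ 12.
Proof. by exists (z / 12%:R); rewrite -(mulr_natr (z / 12%:R)) divfK // Fp12_neq0. Qed.

Lemma Fp_mul12_eq0 (z : 'F_p) : z *+ 12 = 0 -> z = 0.
Proof. by rewrite -(mulr_natr z) => /eqP; rewrite mulf_eq0 (negbTE Fp12_neq0) orbF => /eqP. Qed.

Lemma pairMn (A B : zmodType) (x : A * B) n : x *+ n = (x.1 *+ n, x.2 *+ n).
Proof. by elim: n => [//|n IH]; rewrite !mulrS IH. Qed.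

Lemma sgn_neq (b : bool) : (-1) ^+ b = 1 :> 'F_3 -> b = false.
Proof. by case: b. Qed.

(** The three summands are killed by 4, 3 and p, and 12 is invertible modulo p,
    so an additive map preserves each of them; on F_3 and F_p it is then
    multiplication by the image of 1. *)
Lemma additive_split k k' (L : carrier p k -> carrier p k') :
  {morph L : a b / a + b} -> injective L ->
  exists e (b : bool) (c : 'F_p), [/\ e \in qisos k k', c != 0
    & forall a, L a = (appe e a.1.1, (-1) ^+ b * a.1.2, c * a.2)].
Proof.
move=> LD Linj.
have L0 : L 0 = 0 by apply: (addrI (L 0)); rewrite -LD !addr0.
have LM a n : L (a *+ n) = L a *+ n by elim: n => [//|n IH]; rewrite !mulrS LD IH.
pose S s : carrier p k := (s, 0, 0); pose T t : carrier p k := (0, t, 0).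
pose P z : carrier p k := (0, 0, z).
have dec a : a = S a.1.1 + T a.1.2 + P a.2.
  by case: a => [[s t] z]; apply: carrier_eq; rewrite /= ?addr0 ?add0r.
have LS s : L (S s) = ((L (S s)).1.1, 0, 0).
  have: L (S s) *+ 4 = 0 by rewrite -LM !pairMn /= quad_mul4 !mul0rn L0.
  set b := L (S s); rewrite !pairMn => E.
  have E2 : b.1.2 *+ 4 = 0 := congr1 (fun x => x.1.2) E.
  have E3 : b.2 *+ 4 = 0 := congr1 (fun x => x.2) E.
  apply: carrier_eq => //=; first by move: E2; rewrite mulrS F3_mul3 addr0.
  by apply: Fp_mul12_eq0; rewrite (mulrnA _ 4 3) E3 mul0rn.
have LT t : L (T t) = (0, (L (T t)).1.2, 0).
  have: L (T t) *+ 3 = 0 by rewrite -LM !pairMn /= F3_mul3 !mul0rn L0.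
  set b := L (T t); rewrite !pairMn => E.
  have E1 : b.1.1 *+ 3 = 0 := congr1 (fun x => x.1.1) E.
  have E3 : b.2 *+ 3 = 0 := congr1 (fun x => x.2) E.
  apply: carrier_eq => //=; last by apply: Fp_mul12_eq0; rewrite (mulrnA _ 3 4) E3 mul0rn.
  by move: (quad_mul4 b.1.1); rewrite mulrSr E1 add0r.
have LP z : L (P z) = (0, 0, (L (P z)).2).
  have [y ->] := Fp_div12 z.
  have -> : P (y *+ 12) = P y *+ 12 by rewrite !pairMn /= !mul0rn.
  rewrite LM !pairMn /=; apply: carrier_eq => //=.
    by rewrite (mulrnA _ 4 3) quad_mul4 mul0rn.
  by rewrite (mulrnA _ 3 4) F3_mul3 mul0rn.
pose e := tabulate (fun s => (L (S s)).1.1).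
have eE s : (L (S s)).1.1 = appe e s.
  by rewrite /appe look_tabulate // -/(0 : quadgrp k) [S _]/(0 : carrier p k) L0.
have eI : e \in qisos k k'.
  apply/qisosP; split=> [x y Exy|x y].
    have: L (S x) = L (S y) by rewrite LS [RHS]LS !eE Exy.
    by move/Linj => -[].
  rewrite -!eE -[qadd k x y]/((x : quadgrp k) + (y : quadgrp k)).
  have -> : S ((x : quadgrp k) + y) = S x + S y by apply: carrier_eq => //=; rewrite addr0.
  by rewrite LD.
have TE t : (L (T t)).1.2 = (L (T 1)).1.2 * t.
  have TD x y : (L (T (x + y))).1.2 = (L (T x)).1.2 + (L (T y)).1.2.
    have -> : T (x + y) = T x + T y by apply: carrier_eq => //=; rewrite addr0.
    by rewrite LD.
  have T0 : (L (T 0)).1.2 = 0 by rewrite [T 0]/(0 : carrier p k) L0.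
  by case: (F3_cases t) => ->; rewrite ?TD ?T0 ?mulrDr ?mulr1 ?mulr0.
have [b Eb] : exists b : bool, (L (T 1)).1.2 = (-1) ^+ b.
  case: (F3_cases (L (T 1)).1.2) => E; last by exists true; rewrite E; exact: val_inj.
    have: L (T 1) = L (T 0) by rewrite LT [RHS]LT TE E mul0r TE mulr0.
    by move/Linj => -[].
  by exists false.
have PE z : (L (P z)).2 = (L (P 1)).2 * z.
  rewrite -[z in LHS]natr_Zp -[z in RHS]natr_Zp.
  have -> n : P n%:R = P 1 *+ n by rewrite !pairMn /= !mul0rn.
  by rewrite LM pairMn /= mulr_natr.
exists e, b, (L (P 1)).2; split=> //.
  apply/eqP => E0.
  have: L (P 1) = L (P 0) by rewrite LP [RHS]LP PE E0 mul0r PE mulr0.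
  by move/Linj => -[] /eqP; rewrite oner_eq0.
move=> a; rewrite [a in LHS]dec !LD LS LT LP eE TE PE Eb.
by apply: carrier_eq; rewrite /= ?addr0 ?add0r.
Qed.

End Additive.

(** * The lambda map of a left brace *)

Section Lambda.
Local Open Scope ring_scope.

(** Together with [brace_of_lambda] this replaces the multiplication of a brace
    by a family of automorphisms of its additive group. *)
Lemma lambda_props (G : zmodType) (mul : G -> G -> G) :
  is_left_brace +%R mul ->
  let lam a b := mul a b - a in
  [/\ forall a, {morph lam a : b c / b + c}, forall a, injective (lam a)
    & forall a b c, lam (a + lam a b) c = lam a (lam b c)].
Proof.
move=> [zero [opp [one [inv [[_ z0 _ _ addoppr] _ [mA m1 _ mV _] br]]]]] lam.
have zE : zero = 0 by rewrite -[zero]addr0 z0.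
have oppE a : opp a = - a by apply: (addrI a); rewrite addoppr subrr zE.
have lamD a : {morph lam a : b c / b + c}.
  by move=> b c; rewrite /lam br oppE !addrA.
have mE a b : a + lam a b = mul a b by rewrite addrC subrK.
split=> // [a b c E|a b c].
  rewrite -[b]m1 -[c]m1 -(mV a) -!mA; congr mul; by rewrite -!mE E.
rewrite mE [lam b c]/lam.
have lamB x y : lam a (x - y) = lam a x - lam a y.
  by apply: (addIr (lam a y)); rewrite -lamD !subrK.
by rewrite lamB /lam mA opprB addrA addrNK.
Qed.

Lemma brace_of_lambda (G : zmodType) (lam : G -> G -> G) :
  (forall a, {morph lam a : b c / b + c}) -> (forall a, bijective (lam a)) ->
  (forall a b c, lam (a + lam a b) c = lam a (lam b c)) ->
  is_left_brace +%R (fun a b => a + lam a b).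
Proof.
move=> lamD lamB lamM; set mul := fun a b => a + lam a b.
have lamI a : injective (lam a) := bij_inj (lamB a).
have lam0 a : lam a 0 = 0 by apply: (addrI (lam a 0)); rewrite -lamD !addr0.
have l0 b : lam 0 b = b by apply: (lamI 0); rewrite -lamM lam0 addr0.
have mA : associative mul by move=> a b c; rewrite /mul lamM lamD addrA.
have m1 : left_id 0 mul by move=> a; rewrite /mul l0 add0r.
have mr1 : right_id 0 mul by move=> a; rewrite /mul lam0 addr0.
have /choice[inv mV] : forall a, exists b, mul a b = 0.
  by move=> a; have [h _ hK] := lamB a; exists (h (- a)); rewrite /mul hK addrN.
exists 0, -%R, 0, inv; split; first by split;
  [exact: addrA|exact: add0r|exact: addr0|exact: addNr|exact: addrN].
- exact: addrC.
- split=> // a.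
  have aE : a = inv (inv a) by rewrite -[LHS]mr1 -(mV (inv a)) mA mV m1.
  by rewrite {2}aE mV.
- move=> a b c; rewrite /mul lamD [a + lam a b]addrC -!addrA (addrA (- a)).
  by rewrite addNr add0r addrCA.
Qed.

(** If f z differs from 1, then y = z / (1 - f z) is fixed by y |-> z + f z * y,
    so that f y = f z * f y, and f z = 1 after all. *)
Lemma twisted_character_trivial (F : fieldType) (f : F -> F) :
  (forall z, f z != 0) -> (forall x y, f (x + f x * y) = f x * f y) -> forall z, f z = 1.
Proof.
move=> f0 fM z; apply/eqP/contraT => fz1.
have d0 : 1 - f z != 0 by rewrite subr_eq0 eq_sym.
pose y := z / (1 - f z).
have Ey : z + f z * y = y.
  have Ez : z = (1 - f z) * y by rewrite mulrC divfK.
  by rewrite {1}Ez mulrBl mul1r subrK.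
have := fM z y; rewrite Ey => /eqP; rewrite -{1}[f y]mul1r.
by rewrite (inj_eq (mulIf (f0 y))) eq_sym (negbTE fz1).
Qed.
End Lambda.

(** * Every brace is the model of a code *)

Section Classification.
Local Open Scope ring_scope.

Definition lam_model p (z : 'F_p) (c : code) k (a b : carrier p k) : carrier p k :=
  (appe (lamS c a.1.1 a.1.2) b.1.1, (-1) ^+ c_v c a.1.1 * b.1.2,
   z ^+ lamP c a.1.1 a.1.2 * b.2).

Lemma compe1 e : compe e ide = e.
Proof. by apply: tab_ext => s; rewrite appe_comp /appe [look _ ide _]look_tabulate. Qed.

Lemma sgn3E (b : bool) (t : 'F_3) : ((-1) ^+ b * t : 'F_3) = sgn3 b t :> nat.
Proof. by case: b; case: (F3_cases t) => ->. Qed.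

Lemma F3_addE (t t' : 'F_3) : (t + t' : 'F_3) = ((t + t') %% 3)%N :> nat.
Proof. by []. Qed.

Lemma F3_natr (t : 'F_3) : t = (t : nat)%:R.
Proof. by rewrite natr_Zp. Qed.

Lemma F3_nat n : (n < 3)%N -> (n%:R : 'F_3) = n :> nat.
Proof. by case: n => [|[|[|//]]]. Qed.

Lemma mem_ST (s : quad) (t : 'F_3) : (s, t : nat) \in ST.
Proof. by rewrite allpairs_f ?mem_quads //; case: (F3_cases t) => ->. Qed.

Lemma STP x : x \in ST -> exists s (t : 'F_3), x = (s, t : nat).
Proof.
case/allpairsP => -[s t] [/= _ tI ->]; exists s, (t%:R : 'F_3).
by rewrite F3_nat //; move: tI; rewrite !inE => /or3P[] /eqP ->.
Qed.

Lemma mulST_val (c : code) k p (z : 'F_p) (a b : carrier p k) : c_cyc c = k ->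
  mulST c (a.1.1, a.1.2 : nat) (b.1.1, b.1.2 : nat) =
  ((a + lam_model z c a b).1.1, (a + lam_model z c a b).1.2 : nat).
Proof.
move=> <-; rewrite /mulST; congr (_, _).
by rewrite [RHS]F3_addE sgn3E.
Qed.

Variables (p g : nat) (zeta : 'F_p).
Hypotheses (p_pr : prime p) (p_ge7 : (7 <= p)%N).
Hypothesis zeta_prim : g.-primitive_root zeta.
Hypothesis torsion12 : forall x : 'F_p, x ^+ 12 = 1 -> x ^+ g = 1.

(** The multiplicative group of a brace of order 4 has exponent dividing 4. *)
Lemma pow4_trivial k u s : u \in admissible_u k ->
  let m x y := qadd k x (appe (look ide u x) y) in m s (m s (m s s)) = q0.
Proof.
have: all (fun k => all (fun u => all (fun s =>
   let m x y := qadd k x (appe (look ide u x) y) in m s (m s (m s s)) == q0)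
   quads) (admissible_u k)) [:: false; true] by vm_compute.
move=> /allP/(_ k); have -> : k \in [:: false; true] by case: k.
move=> /(_ isT)/allP uA /uA/allP/(_ s (mem_quads s))/eqP; exact.
Qed.

Lemma iso_pow12 k e : e \in qisos k k -> iter 12 (compe e) ide = ide.
Proof.
have: all (fun k => all (fun e => iter 12 (compe e) ide == ide) (qisos k k))
  [:: false; true] by vm_compute.
move=> /allP/(_ k); have -> : k \in [:: false; true] by case: k.
by move=> /(_ isT)/allP eA /eA/eqP.
Qed.

(** The restrictions of lam to P, then T, then S are determined in turn; the
    code is read off from the values on S and at the generator of T. *)
Lemma brace_code k (mul : carrier p k -> carrier p k -> carrier p k) :
  is_left_brace +%R mul ->
  exists c, [/\ c \in codes g, c_cyc c = k & forall a b, mul a b = a + lam_model zeta c a b].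
Proof.
move=> /lambda_props; set lam := fun a b => mul a b - a.
move=> [lamD lamI lamM].
have mul_lam a b : mul a b = a + lam a b by rewrite addrC subrK.
have [UVW UVWP] := choice (fun a => 
  let: ex_intro e (ex_intro b (ex_intro c H)) := additive_split p_pr p_ge7 (lamD a) (@lamI a) in
  ex_intro (fun x : tab quad * bool * 'F_p => [/\ x.1.1 \in qisos k k, x.2 != 0
    & forall y, lam a y = (appe x.1.1 y.1.1, (-1) ^+ x.1.2 * y.1.2, x.2 * y.2)]) (e, b, c) H).
pose U a := (UVW a).1.1; pose V a := (UVW a).1.2; pose W a := (UVW a).2.
have UI a : U a \in qisos k k by case: (UVWP a).
have W0 a : W a != 0 by case: (UVWP a).
have lamE a y : lam a y = (appe (U a) y.1.1, (-1) ^+ V a * y.1.2, W a * y.2).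
  by case: (UVWP a).
have uniq3 a e (b : bool) w :
  (forall y, lam a y = (appe e y.1.1, (-1) ^+ b * y.1.2, w * y.2)) ->
  [/\ U a = e, V a = b & W a = w].
  move=> E; have E' y := etrans (esym (lamE a y)) (E y).
  split.
  - by apply: tab_ext => s; have := congr1 (fun x => x.1.1) (E' (s, 0, 0)).
  - have := congr1 (fun x => x.1.2) (E' (0, 1, 0)); rewrite /= !mulr1.
    by case: (V a) (b) => [] [].
  - by have := congr1 (fun x => x.2) (E' (0, 0, 1)); rewrite /= !mulr1.
have hom a b : [/\ U (a + lam a b) = compe (U a) (U b),
    V (a + lam a b) = V a (+) V b & W (a + lam a b) = W a * W b].
  apply: uniq3 => y; rewrite lamM !lamE /= appe_comp.
  by rewrite signr_addb !mulrA.
have lam00 a : lam a 0 = 0 by apply: (addrI (lam a 0)); rewrite -lamD !addr0.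
have lam0 b : lam 0 b = b by apply: (lamI 0); rewrite -lamM lam00 addr0.
have [U0 V0 W_0] : [/\ U 0 = ide, V 0 = false & W 0 = 1].
  apply: uniq3 => y; rewrite lam0 expr0 !mul1r /appe look_tabulate //.
  by case: y => [[? ?] ?].
pose S s : carrier p k := (s, 0, 0); pose T t : carrier p k := (0, t, 0).
pose P z : carrier p k := (0, 0, z).
(* On P the multiplication is the addition, and every z is 12 y for some y,
   while the automorphisms of S and the signs have exponent dividing 12. *)
have PP x y : P x + lam (P x) (P y) = P (x + W (P x) * y).
  by rewrite lamE; apply: carrier_eq; rewrite /= ?mulr0 ?addr0.
have WP z : W (P z) = 1.
  apply: (@twisted_character_trivial _ (fun z => W (P z))) => // x y.
  by case: (hom (P x) (P y)); rewrite PP.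
have UVPn z n : U (P (z *+ n)) = iter n (compe (U (P z))) ide /\ 
     V (P (z *+ n)) = iter n (addb (V (P z))) false.
  elim: n => [|n [IHU IHV]]; first by rewrite mulr0n U0 V0.
  have [] := hom (P z) (P (z *+ n)).
  by rewrite PP WP mul1r -mulrS => -> -> _; rewrite IHU IHV.
have lamP_id z b : lam (P z) b = b.
  have [y ->] := Fp_div12 p_pr p_ge7 z; rewrite lamE.
  have [-> ->] := UVPn y 12; rewrite (iso_pow12 (UI _)) WP.
  have -> : iter 12 (addb (V (P y))) false = false by case: (V _).
  rewrite expr0 !mul1r /appe look_tabulate //.
  by case: b => [[? ?] ?].
have lamST s t z b : lam (s, t, z) b = lam (S s) (lam (T ((-1) ^+ V (S s) * t)) b).
  have E1 : S s + lam (S s) (T ((-1) ^+ V (S s) * t)) = (s, t, 0).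
    rewrite lamE; apply: carrier_eq; rewrite /= ?mulr0 ?addr0 ?add0r //.
    by rewrite mulrA -expr2 sqrr_sign mul1r.
  rewrite -lamM E1 -[RHS](lamP_id z) -lamM lamP_id.
  by congr (lam _ b); apply: carrier_eq; rewrite /= ?addr0 ?add0r.
(* The fixed point argument applies to the sign v on T as well; so the
   multiplication on T is its addition. *)
have TT x y : T x + lam (T x) (T y) = T (x + (-1) ^+ V (T x) * y).
  by rewrite lamE; apply: carrier_eq; rewrite /= ?mulr0 ?addr0.
have VT t : V (T t) = false.
  apply: sgn_neq; apply: (@twisted_character_trivial _ (fun t => (-1) ^+ V (T t))) => [z|x y].
    by rewrite signr_eq0.
  by case: (hom (T x) (T y)); rewrite TT => _ -> _; rewrite signr_addb.
pose ut := U (T 1).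
have UWT (t : 'F_3) : U (T t) = iter t (compe ut) ide /\ W (T t) = W (T 1) ^+ t.
  suff UWTn n : U (T n%:R) = iter n (compe ut) ide /\ W (T n%:R) = W (T 1) ^+ n.
    by move: (UWTn t); rewrite -F3_natr.
  elim: n => [|n [IHU IHW]]; first by rewrite U0 W_0.
  have [] := hom (T 1) (T n%:R).
  by rewrite TT VT mul1r -mulrS => -> _ ->; rewrite IHU IHW exprS.
have W3 : W (T 1) ^+ 3 = 1.
  have := UWT 1; case: (hom (T 1) (T (1 + 1))) => _ _.
  rewrite TT VT mul1r (_ : 1 + (1 + 1) = 0); last exact: val_inj.
  by rewrite W_0 (UWT (1 + 1)).2 /= => ->.
have SS x y : S x + lam (S x) (S y) = S (qadd k x (appe (U (S x)) y)).
  by rewrite lamE; apply: carrier_eq; rewrite /= ?mulr0 ?addr0.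
pose u := tabulate (fun s => U (S s)).
pose v := tabulate (fun s => V (S s)).
have uE s : look ide u s = U (S s) by apply: look_tabulate; exact: U0.
have vE s : look false v s = V (S s) by apply: look_tabulate; exact: V0.
have uI : u \in admissible_u k.
  rewrite mem_filter mem_tabs_tabulate ?andbT => [|s]; last exact: UI.
  apply/allP=> x _; apply/allP=> y _; rewrite !uE.
  by case: (hom (S x) (S y)) => <- _ _; rewrite SS.
have vI : v \in admissible_v k u.
  rewrite mem_filter mem_tabs_tabulate ?andbT => [|s]; last by case: (V _).
  apply/allP=> x _; apply/allP=> y _; rewrite !vE uE.
  by case: (hom (S x) (S y)) => _ <- _; rewrite SS.
have W4 s : W (S s) ^+ 4 = 1.
  have WM x y : W (S x) * W (S y) = W (S (qadd k x (appe (U (S x)) y))).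
    by case: (hom (S x) (S y)) => _ _ <-; rewrite SS.
  have := pow4_trivial s uI; rewrite /= !uE => E.
  by rewrite !exprS mulr1 !WM E.
(* The scalars are 12th roots of unity, hence powers of zeta. *)
have g_gt0 : (0 < g)%N := prim_order_gt0 zeta_prim.
have /choice[ex exP] : forall x : 'F_p, exists i,
    x ^+ 12 = 1 -> (i < g)%N /\ x = zeta ^+ i.
  move=> x; case: (x ^+ 12 =P 1) => [/torsion12 x1|ne]; last by exists 0%N.
  by have [i ->] := prim_rootP zeta_prim x1; exists i.
(* At q0 the table w returns its default 0, which must be the exponent of 1. *)
have ex1 : ex 1 = 0%N.
  have [lt_g /esym/eqP] := exP 1 (expr1n _ _).
  rewrite -(prim_order_dvd zeta_prim); case: (ex 1) lt_g => // n lt_g.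
  by move/dvdn_leq => /(_ isT); rewrite leqNgt lt_g.
have zeta_eq i j : (zeta ^+ i == zeta ^+ j) = (i == j %[mod g]).
  exact: eq_prim_root_expr.
pose w := tabulate (fun s => ex (W (S s))).
have wE s : look 0%N w s = ex (W (S s)).
  by rewrite look_tabulate // [S q0]/(0 : carrier p k) W_0.
have exS s : (ex (W (S s)) < g)%N /\ W (S s) = zeta ^+ ex (W (S s)).
  by apply: exP; rewrite (exprM _ 4 3) W4 expr1n.
have [exT1 exT2] : (ex (W (T 1%R)) < g)%N /\ W (T 1) = zeta ^+ ex (W (T 1)).
  by apply: exP; rewrite (exprM _ 3 4) W3 expr1n.
have wI : w \in admissible_w g k u.
  rewrite mem_filter mem_tabs_tabulate ?andbT => [|s].
    apply/allP=> x _; apply/allP=> y _; rewrite !wE uE.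
    have -> : ex (W (S (qadd k x (appe (U (S x)) y)))) =
      (ex (W (S (qadd k x (appe (U (S x)) y)))) %% g)%N by rewrite modn_small // (exS _).1.
    rewrite -zeta_eq exprD -!(exS _).2.
    by case: (hom (S x) (S y)) => _ _ <-; rewrite SS.
  rewrite mem_filter mem_iota (exS s).1 andbT (prim_order_dvd zeta_prim).
  by rewrite mulnC exprM -(exS s).2 W4.
have wtI : ex (W (T 1)) \in torsion g 3.
  rewrite mem_filter mem_iota exT1 andbT (prim_order_dvd zeta_prim).
  by rewrite mulnC exprM -exT2 W3.
have utI : ut \in admissible_ut k.
  rewrite mem_filter [ut \in _]UI andbT.
  case: (hom (T 1) (T (1 + 1))); rewrite TT VT mul1r.
  rewrite (_ : 1 + (1 + 1) = 0); last exact: val_inj.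
  by rewrite U0 (UWT (1 + 1)).1 /= compe1 => <-.
pose c : code := (k, u, v, w, ut, ex (W (T 1))).
have lam_c a b : lam a b = lam_model zeta c a b.
  case: a => [[s t] z]; rewrite lamST !lamE (UWT _).1 (UWT _).2 VT expr0 mul1r.
  rewrite sgn3E /lam_model /lamS /lamP /c_u /c_v /c_w /= uE vE wE appe_comp.
  by rewrite exprD mulnC exprM -(exS s).2 -exT2 mulrA.
have UVW_c s t : [/\ U (s, t, 0) = lamS c s t, V (s, t, 0) = c_v c s
    & W (s, t, 0) = zeta ^+ lamP c s t].
  by apply: uniq3 => b; rewrite lam_c.
exists c; split=> [||a b] //; last by rewrite mul_lam lam_c.
rewrite mem_filter; apply/andP; split; last first.
  apply/flatten_mapP; exists k; first by case: (k).
  apply/flatten_mapP; exists u => //.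
  apply/allpairsP; exists ((v, w), (ut, ex (W (T 1)))).
  by split=> //=; apply: allpairs_f.
apply/allP=> _ /STP[s [t ->]]; apply/andP; split.
  by have [<- _ _] := UVW_c s t; move: (UI (s, t, 0)); rewrite mem_filter => /andP[].
apply/allP=> _ /STP[s' [t' ->]].
pose a : carrier p k := (s, t, 0); pose a' : carrier p k := (s', t', 0).
rewrite (mulST_val zeta a a' (erefl : c_cyc c = k)) -lam_c.
have [ha hb hc] := hom a a'.
have ab2 : (a + lam a a').2 = 0 by rewrite lamE /= mulr0 addr0.
move: (a + lam a a') ab2 ha hb hc => [[s2 t2] _] /= ->.
rewrite /a /a'; have [-> -> ->] := UVW_c s t; have [-> -> ->] := UVW_c s' t'.
have [-> -> ->] := UVW_c s2 t2 => -> -> /eqP; rewrite -exprD zeta_eq => ->.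
by rewrite !eqxx.
Qed.
End Classification.

(** * Models of codes, and their isomorphisms *)

Section Models.
Local Open Scope ring_scope.
Variables (p g : nat) (zeta : 'F_p).
Hypotheses (p_pr : prime p) (p_ge7 : (7 <= p)%N).
Hypothesis zeta_prim : g.-primitive_root zeta.

Lemma sign3_neq0 (b : bool) : (-1) ^+ b != 0 :> 'F_3.
Proof. by rewrite signr_eq0. Qed.

Definition mul_model c k (a b : carrier p k) : carrier p k :=
  a + lam_model zeta c a b.

Lemma zeta_neq0 : zeta != 0.
Proof.
apply/eqP => z0; have /eqP := prim_expr_order zeta_prim.
by rewrite z0 expr0n gtn_eqF ?(prim_order_gt0 zeta_prim) // eq_sym oner_eq0.
Qed.

Lemma admissibleP c s t s' t' : admissible g c -> (s, t) \in ST -> (s', t') \in ST ->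
  let ab := mulST c (s, t) (s', t') in
  [/\ lamS c s t \in qisos (c_cyc c) (c_cyc c),
      lamS c ab.1 ab.2 = compe (lamS c s t) (lamS c s' t'),
      c_v c ab.1 = c_v c s (+) c_v c s'
    & lamP c ab.1 ab.2 = lamP c s t + lamP c s' t' %[mod g]]%N.
Proof.
move=> /allP H aI bI ab.
have /andP[iso /allP/(_ _ bI)/and3P[/eqP h1 /eqP h2 /eqP h3]] := H _ aI.
split=> //; rewrite mem_filter iso; case: (lamS c s t) => [[x y] z].
by rewrite mem_tabs ?mem_quads.
Qed.

Lemma model_brace c k : admissible g c -> c_cyc c = k -> is_left_brace +%R (@mul_model c k).
Proof.
move=> adm ck; apply: brace_of_lambda => [a b b'|a|a b d].
- have [iso _ _ _] := admissibleP adm (mem_ST a.1.1 a.1.2) (mem_ST a.1.1 a.1.2).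
  move: iso; rewrite ck => /qisosP[_ isoD].
  by apply: carrier_eq; rewrite /= ?mulrDr //; apply: isoD.
- have [iso _ _ _] := admissibleP adm (mem_ST a.1.1 a.1.2) (mem_ST a.1.1 a.1.2).
  apply: inj_card_bij => // {}b b' E; move: iso; rewrite ck => /qisosP[isoI _].
  apply: carrier_eq.
  + by apply: isoI; apply: (congr1 (fun x => x.1.1) E).
  + have := congr1 (fun x => x.1.2) E; rewrite /= => /mulfI; apply.
    by rewrite signr_eq0.
  + have := congr1 (fun x => x.2) E; rewrite /= => /mulfI; apply.
    by rewrite expf_neq0 // zeta_neq0.
- have := admissibleP adm (mem_ST a.1.1 a.1.2) (mem_ST b.1.1 b.1.2).
  rewrite (mulST_val zeta a b ck); move: (a + lam_model zeta c a b) => [[s t] z] /=.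
  move=> [_ h1 h2 h3]; apply: carrier_eq;
    rewrite /= ?h1 ?h2 ?appe_comp ?signr_addb ?mulrA //.
  by rewrite -exprD; congr (_ * _); apply/eqP; rewrite (eq_prim_root_expr zeta_prim) h3.
Qed.

(** By [additive_split] an isomorphism f is a triple (e, sign, m), and it
    intertwines lam: f o lam_a = lam_(f a) o f.  Evaluating this at (s, t, 0)
    component by component gives [equivc]; the scalar m cancels, so m = 1 serves
    for the converse. *)
Lemma model_isoP c d : admissible g c -> admissible g d ->
  brace_isomorphic +%R (@mul_model c (c_cyc c)) +%R (@mul_model d (c_cyc d)) <-> equivc g c d.
Proof.
move=> admc admd; set k := c_cyc c; set k' := c_cyc d.
have lam_iso (f : carrier p k -> carrier p k') : {morph f : a b / a + b} ->
  (forall a b, f (lam_model zeta c a b) = lam_model zeta d (f a) (f b)) <->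
  {morph f : a b / mul_model c a b >-> mul_model d a b}.
  move=> fD; split=> H a b; first by rewrite /mul_model fD H.
  by apply: (addrI (f a)); rewrite -fD H.
split=> [[f [[f' fK f'K] fD fM]]|].
  have {}fM := (lam_iso f fD).2 fM.
  have [e [b [m [eI m0 fE]]]] := additive_split p_pr p_ge7 fD (can_inj fK).
  apply/hasP; exists e => //; apply/hasP; exists b; first by case: (b).
  apply/allP => _ /STP[s [t ->]] /=.
  have [t' t'E fa] : exists2 t' : 'F_3, t' = sgn3 b t :> nat & f (s, t, 0) = (appe e s, t', 0).
    by exists ((-1) ^+ b * t); [exact: sgn3E | rewrite fE /= mulr0].
  have fM1 y := fM (s, t, 0) y; rewrite fa /lam_model /= t'E in fM1.
  apply/and3P; split.
  - apply/eqP/tab_ext => x; rewrite appe_comp [RHS]appe_comp.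
    by have := congr1 (fun x => x.1.1) (fM1 (x, 0, 0)); rewrite !fE.
  - have := congr1 (fun x => x.1.2) (fM1 (0, 1, 0)).
    rewrite !fE /= !mulr1 [LHS]mulrC => /(mulIf (sign3_neq0 _)).
    by case: (c_v c s) (c_v d _) => [] [].
  - have := congr1 (fun x => x.2) (fM1 (0, 0, 1)).
    rewrite !fE /= !mulr1 mulrC => /(mulIf m0) /eqP.
    by rewrite (eq_prim_root_expr zeta_prim).
move=> /hasP[e eI /hasP[b _ /allP H]].
have /qisosP[einj eD] := eI.
pose f (a : carrier p k) : carrier p k' := (appe e a.1.1, (-1) ^+ b * a.1.2, a.2).
have fD : {morph f : a b / a + b}.
  by move=> x y; apply: carrier_eq; rewrite /= ?mulrDr //; apply: eD.
exists f; split=> //.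
  have finj : injective f.
    move=> x y E; apply: carrier_eq.
    - by apply: einj; apply: (congr1 (fun x => x.1.1) E).
    - by apply: (mulfI (sign3_neq0 b)); apply: (congr1 (fun x => x.1.2) E).
    - exact: (congr1 (fun x => x.2) E).
  exact: inj_card_bij.
apply/lam_iso => // x y.
have /and3P[/eqP h1 /eqP h2 /eqP h3] := H _ (mem_ST x.1.1 x.1.2).
have E : sgn3 b x.1.2 = (f x).1.2 :> nat by rewrite sgn3E.
move: h1 h3; rewrite /= E => h1 h3; apply: carrier_eq.
- by have := congr1 (appe^~ y.1.1) h1; rewrite /= (appe_comp e) (appe_comp _ e).
- by rewrite /= h2 mulrCA.
- by congr (_ * _); apply/eqP; rewrite (eq_prim_root_expr zeta_prim) h3.
Qed.
End Models.

(** * Abelian groups of order 12p *)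

Section Groups.
Local Open Scope group_scope.
Variable gT : finGroupType.
Hypothesis mulgC : forall x y : gT, x * y = y * x.

Lemma mulgACA (a b c d : gT) : (a * b) * (c * d) = (a * c) * (b * d).
Proof. by rewrite -!mulgA; congr (_ * _); rewrite mulgA [b * c]mulgC -mulgA. Qed.

(** A group of order 4 either has an element x of order 4, and then a + 2b |-> x^(a + 2b)
    is an isomorphism, or all its squares are trivial, and any two distinct
    x, y other than 1 form a basis. *)
Lemma group4_quadgrp (S : {group gT}) : #|S| = 4 ->
  exists k (f : quadgrp k -> gT),
    injective f /\ {morph f : x y / (x + y)%R >-> x * y}.
Proof.
move=> S4.
have [/existsP[x /andP[xS /eqP ox]]|no4] := boolP [exists x in S, #[x] == 4].
  exists true, (fun s : quad => x ^+ (s.1 + 2 * s.2)); split.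
    move=> s t /eqP; rewrite eq_expg_mod_order ox.
    by case: s t => [[] []] [[] []].
  move=> s t; rewrite -expgD; apply/eqP; rewrite eq_expg_mod_order ox.
  by case: s t => [[] []] [[] []].
have sq x : x \in S -> x * x = 1.
  move=> xS; apply/eqP; rewrite -[x * x]/(x ^+ 2) -order_dvdn.
  have : #[x] %| 4 by rewrite -S4 order_dvdG.
  move: no4; rewrite negb_exists => /forallP/(_ x); rewrite xS /=.
  have := order_gt0 x; by case: #[x] => [|[|[|[|[|n]]]]].
have [x xS x1] : exists2 x, x \in S & x != 1.
  by apply/trivgPn; rewrite trivg_card1 S4.
have [y yS yx] : exists2 y, y \in S & y \notin [set 1; x].
  apply/subsetPn; apply: contraTN isT => /subset_leq_card.
  by rewrite S4 cards2; case: (_ != _).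
have {yx} [y1 yx] : y != 1 /\ y != x.
  by move: yx; rewrite !inE negb_or => /andP.
have xy1 : x * y != 1.
  by apply: contraNneq yx => xy1; rewrite -(inj_eq (mulgI x)) xy1 sq.
exists false, (fun s : quad => x ^+ s.1 * y ^+ s.2).
have fM : {morph (fun s : quadgrp false => x ^+ s.1 * y ^+ s.2) :
    a b / (a + b)%R >-> a * b}.
  move=> a b; rewrite mulgACA -!expgD; congr (_ * _).
    by case: a b => [[] ?] [[] ?] //; rewrite -[RHS]/(x * x) sq.
  by case: a b => [[] []] [[] []] //; rewrite -[RHS]/(y * y) sq.
split=> // a b /= E.
have {}E : x ^+ (a - b)%R.1 * y ^+ (a - b)%R.2 = 1.
  have := fM (a - b)%R b; rewrite subrK /= E -[LHS]mul1g => /mulIg ->.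
  by [].
apply/eqP; rewrite -subr_eq0; case: (a - b)%R E => [[] []] //= /eqP;
  rewrite ?expg1 ?expg0 ?mulg1 ?mul1g.
- by rewrite (negbTE xy1).
- by rewrite (negbTE x1).
- by rewrite (negbTE y1).
Qed.

(** The product of a Sylow 2-subgroup with cyclic groups of order 3 and p; the sum
    is direct because the orders are coprime. *)
Lemma abelian_group_carrier p : prime p -> 7 <= p -> #|gT| = (12 * p)%N ->
  exists k (f : carrier p k -> gT),
    bijective f /\ {morph f : x y / (x + y)%R >-> x * y}.
Proof.
move=> p_pr p_ge7 oG.
have oG' : #|[set: gT]| = (12 * p)%N by rewrite cardsT.
have [S sylS] := Sylow_exists 2 [set: gT]%G.
have S4 : #|S| = 4.
  rewrite (card_Hall sylS) oG' partnM // ?prime_gt0 //.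
  rewrite [(p`_2)%N]part_p'nat ?muln1 ?p_part //.
  rewrite p'natE // dvdn_prime2 //; by apply: contraTneq p_ge7 => <-.
have [k [f [f_inj fM]]] := group4_quadgrp S4.
have [c _ oc] : {c | c \in [set: gT] & #[c] = 3}.
  by apply: Cauchy => //; rewrite oG' dvdn_mulr.
have [d _ od] : {d | d \in [set: gT] & #[d] = p}.
  by apply: Cauchy => //; rewrite oG' dvdn_mull.
pose F (a : carrier p k) := f a.1.1 * c ^+ (a.1.2 : 'F_3) * d ^+ (a.2 : 'F_p).
have FM : {morph F : x y / (x + y)%R >-> x * y}.
  move=> x y; rewrite /F [RHS]mulgACA -expgD [X in _ = X * _]mulgACA -expgD -fM.
  congr (_ * _ * _).
    by rewrite -[RHS]expg_mod_order oc.
  by rewrite -[RHS]expg_mod_order od; congr (d ^+ (_ %% _)); apply: Fp_cast.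
have F0 : F 0%R = 1 by apply: (mulgI (F 0%R)); rewrite -FM addr0 mulg1.
have f0 : f 0%R = 1 by apply: (mulgI (f 0%R)); rewrite -fM addr0 mulg1.
have FX a n : F (a *+ n)%R = F a ^+ n.
  by elim: n => [|n IH]; rewrite ?mulr0n ?F0 // mulrS FM IH expgS.
have Fp_dvd0 (z : 'F_p) : p %| z -> z = 0%R.
  have zp : z < p by rewrite -[X in _ < X](Fp_cast p_pr) ltn_ord.
  move=> dvd_z; apply: val_inj => /=; case: (nat_of_ord z) zp dvd_z => // n zp.
  by move=> /(dvdn_leq (ltn0Sn n)); rewrite leqNgt zp.
have F_ker a : F a = 1 -> a = 0%R.
  move=> Fa1.
  have a2 : a.2 = 0%R.
    apply: (Fp_mul12_eq0 p_pr p_ge7).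
    set z := (a.2 *+ 12)%R.
    have E : (a *+ 12)%R = (0%R, 0%R, z) :> carrier p k.
      rewrite !pairMn; apply: carrier_eq => //.
        by rewrite (mulrnA _ 4 3) quad_mul4 mul0rn.
      by rewrite /= (mulrnA a.1.2 3 4) F3_mul3 mul0rn.
    have := FX a 12; rewrite E Fa1 expg1n /F /= f0 !mul1g => /eqP.
    by rewrite -order_dvdn od => dvd_z; apply: (Fp_dvd0 z).
  have a12 : a.1.2 = 0%R.
    have E : (a *+ 4)%R = (0%R, a.1.2, 0%R) :> carrier p k.
      rewrite !pairMn a2 mul0rn; apply: carrier_eq => //; first exact: quad_mul4.
      by rewrite /= mulrS F3_mul3 addr0.
    have := FX a 4; rewrite E Fa1 expg1n /F /= f0 mul1g mulg1 => /eqP.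
    rewrite -order_dvdn oc.
    by case: (F3_cases a.1.2) => ->.
  apply: carrier_eq => //; apply: f_inj; rewrite f0.
  by move: Fa1; rewrite /F a2 a12 !expg0 !mulg1.
exists k, F; split=> //; apply: inj_card_bij.
  move=> x y E; apply/eqP; rewrite -subr_eq0; apply/eqP/F_ker.
  by apply: (mulIg (F y)); rewrite -FM subrK mul1g.
by rewrite oG !card_prod !card_bool card_ord card_Fp.
Qed.
End Groups.

(** * Counting isomorphism classes *)

Lemma card_equivalence_partition_reps (T : finType) (R : rel T) (D : {set T})
    (I : eqType) (r : seq I) (M : I -> T) :
  {in D & &, equivalence_rel R} ->
  {in r, forall i, M i \in D} ->
  pairwise (fun i j => ~~ R (M i) (M j)) r ->
  {in D, forall x, exists2 i, i \in r & R x (M i)} ->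
  #|equivalence_partition R D| = size r.
Proof.
move=> eqR MD pw cover; pose cl x := [set y in D | R x y].
have RD x : x \in D -> R x x by move=> xD; case: (eqR x x x xD xD xD).
have sub x y z : x \in D -> y \in D -> z \in D -> R x y -> R x z = R y z.
  by move=> xD yD zD; case: (eqR x y z xD yD zD) => _.
have clE x y : x \in D -> y \in D -> (cl x == cl y) = R x y.
  move=> xD yD; apply/eqP/idP => [E|xy].
    by have : y \in cl y by [rewrite inE yD RD]; rewrite -E inE yD.
  by apply/setP=> z; rewrite !inE; case: (boolP (z \in D)) => //= zD; apply: sub.
have clU : uniq [seq cl (M i) | i <- r].
  elim: r MD pw {cover} => //= i r IH MD /andP[nr pw].
  rewrite IH //; last by move=> j jr; apply: MD; rewrite inE jr orbT.
  rewrite andbT; apply/mapP => -[j jr /eqP].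
  rewrite clE ?MD ?mem_head //; last by rewrite inE jr orbT.
  by apply/negP; apply: (allP nr).
rewrite -(size_map (cl \o M)) -(card_uniqP clU); apply: eq_card => B.
apply/imsetP/mapP => [[x xD ->]|[i ir ->]]; last by exists (M i); rewrite ?MD.
have [i ir xi] := cover x xD; exists i => //.
by apply/eqP; rewrite -/(cl x) clE ?MD.
Qed.

Section PrimRoot.
Local Open Scope ring_scope.
Lemma Fp_expr_pred p (x : 'F_p) : prime p -> x != 0 -> x ^+ p.-1 = 1.
Proof.
move=> p_pr x0; apply: (mulfI x0).
rewrite -exprS prednK ?prime_gt0 // mulr1.
by have := expf_card x; rewrite card_Fp.
Qed.

Lemma Fp_prim_root p : prime p -> exists zeta : 'F_p, (gcdn 12 p.-1).-primitive_root zeta.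
Proof.
move=> p_pr; have p1 : (0 < p.-1)%N by rewrite -subn1 subn_gt0 prime_gt1.
have /hasP[z _ z_prim] : has (p.-1).-primitive_root (enum (predC1 (0 : 'F_p))).
  apply: has_prim_root; rewrite ?enum_uniq //.
    by apply/allP=> x; rewrite mem_enum => x0; rewrite unity_rootE Fp_expr_pred.
  by rewrite -cardE cardC1 card_Fp.
exists (z ^+ (p.-1 %/ gcdn 12 p.-1)); apply: dvdn_prim_root => //; exact: dvdn_gcdr.
Qed.

(** The exponents that kill x form an ideal of the integers. *)
Lemma Fp_torsion12 p (x : 'F_p) : prime p -> x ^+ 12 = 1 -> x ^+ gcdn 12 p.-1 = 1.
Proof.
move=> p_pr x12.
have x0 : x != 0 by apply: contra_eq_neq x12 => ->; rewrite expr0n eq_sym oner_eq0.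
have [km kn E _] := egcdnP p.-1 (isT : (0 < 12)%N).
have : x ^+ (km * 12) = 1 by rewrite mulnC exprM x12 expr1n.
by rewrite E exprD mulnC exprM Fp_expr_pred // expr1n mul1r.
Qed.
End PrimRoot.

Section Count.
Variables (p : nat).
Hypotheses (p_pr : prime p) (p_ge7 : 7 <= p).
Let g := gcdn 12 p.-1.

Lemma brace_iso_sym T U (a m : T -> T -> T) (a' m' : U -> U -> U) :
  brace_isomorphic a m a' m' -> brace_isomorphic a' m' a m.
Proof.
move=> [f [[h fK hK] fD fM]]; exists h; split; first by exists f.
  by move=> x y; rewrite -{1}[x]hK -{1}[y]hK -fD fK.
by move=> x y; rewrite -{1}[x]hK -{1}[y]hK -fM fK.
Qed.

Lemma brace_iso_trans T U V (a m : T -> T -> T) (a' m' : U -> U -> U) (a2 m2 : V -> V -> V) :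
  brace_isomorphic a m a' m' -> brace_isomorphic a' m' a2 m2 ->
  brace_isomorphic a m a2 m2.
Proof.
move=> [f [fb fD fM]] [h [hb hD hM]]; exists (h \o f); split; first exact: bij_comp.
  by move=> x y /=; rewrite fD hD.
by move=> x y /=; rewrite fM hM.
Qed.

(** The multiplication is transported along an isomorphism of additive groups. *)
Lemma carrier_transport (add mul : 'I_(12 * p) -> 'I_(12 * p) -> 'I_(12 * p)) :
  is_left_brace add mul ->
  exists k (mul' : carrier p k -> carrier p k -> carrier p k),
    is_left_brace +%R mul' /\ brace_isomorphic add mul +%R mul'.
Proof.
move=> br; have [z [o [e [i [[Aa Al Ar Avl Avr] Ac [Ma Ml Mr Mvl Mvr] brax]]]]] := br.
pose isG := Finite_isGroup.Build 'I_(12 * p) Aa Al Avl.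
pose gT : finGroupType := HB.pack 'I_(12 * p) isG.
have [k [f [[h fK hK] fM]]] := @abelian_group_carrier gT Ac p p_pr p_ge7 (card_ord _).
have fD x y : f (x + y)%R = add (f x) (f y) := fM x y.
exists k, (fun x y => h (mul (f x) (f y))); split; last first.
  apply: brace_iso_sym; exists f; split=> //; first by exists h.
exists 0%R, (@GRing.opp _), (h e), (fun x => h (i (f x))).
split; [|exact: addrC| |].
- by split; [exact: addrA|exact: add0r|exact: addr0|exact: addNr|exact: addrN].
- split=> [x y t|x|x|x|x]; rewrite ?hK //.
  + by rewrite Ma.
  + by rewrite Ml.
  + by rewrite Mr.
  + by rewrite Mvl.
  + by rewrite Mvr.
- move=> x y t; apply: (can_inj fK); rewrite !fD !hK brax.
  congr (add (add _ _) _).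
  have f0 : f 0%R = z.
    by rewrite -[LHS]Al -(Avl (f 0%R)) -Aa -fD addr0 Avl.
  rewrite -[LHS]Ar -f0 -(addrN x) fD Aa Avl.
  by rewrite Al.
Qed.

(** The models of the codes in [reps g] are pairwise non-isomorphic, and each
    brace is isomorphic to one of them. *)
Lemma num_left_braces_reps : num_left_braces (12 * p) = size (reps g).
Proof.
have [zeta zeta_prim] := Fp_prim_root p_pr.
have tors x : (x ^+ 12 = 1 -> x ^+ g = 1)%R := @Fp_torsion12 p x p_pr.
have adm c : c \in codes g -> admissible g c by rewrite mem_filter => /andP[].
have card_carrier k : #|{: carrier p k}| = 12 * p.
  by rewrite !card_prod !card_bool card_ord card_Fp.
have n_gt0 : 0 < 12 * p by rewrite muln_gt0 /= prime_gt0.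
have /choice[M MP] : forall c, exists B,
  admissible g c -> B \in left_braces (12 * p) /\
  brace_isomorphic +%R (@mul_model p zeta c (c_cyc c)) (tadd B) (tmul B).
  move=> c; case: (boolP (admissible g c)) => [ac|_]; last first.
    by exists ([ffun => Ordinal n_gt0], [ffun => Ordinal n_gt0]).
  have br := model_brace zeta_prim ac (erefl (c_cyc c)).
  by have [B BI Biso] := left_brace_on_ord (card_carrier _) br; exists B.
have MI c : c \in codes g -> M c \in left_braces (12 * p) by move=> /adm /MP[].
have Miso c := (MP c _).2.
have isoM c d : c \in codes g -> d \in codes g ->
    isomorphic_tables (M c) (M d) = equivc g c d.
  move=> /adm ac /adm ad.
  have isoc := (MP c ac).2; have isod := (MP d ad).2.
  apply/asboolP/idP => [cd|cd].
    apply/(model_isoP p_pr p_ge7 zeta_prim ac ad).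
    exact: brace_iso_trans isoc (brace_iso_trans cd (brace_iso_sym isod)).
  apply: brace_iso_trans (brace_iso_sym isoc) (brace_iso_trans _ isod).
  exact/(model_isoP p_pr p_ge7 zeta_prim ac ad).
have eqR := @isomorphic_tables_equiv (12 * p).
apply: (@card_equivalence_partition_reps _ _ _ _ (reps g) M) => //.
- by move=> c /greedy_sub; apply: MI.
- apply: (sub_in_pairwise (P := mem (codes g))) (greedy_pairwise (equivc g) _).
    by move=> c d cI dI; rewrite isoM.
  by apply/allP; apply: greedy_sub.
- move=> B; rewrite inE => /asboolP br.
  have [k [mul [br' iso']]] := carrier_transport br.
  have [c [cI ck mulST]] := brace_code p_pr p_ge7 zeta_prim tors br'.
  subst k.
  have BMc : isomorphic_tables B (M c).
    apply/asboolP; apply: brace_iso_trans (MP c (adm c cI)).2.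
    apply: brace_iso_trans iso' _.
    by exists id; split=> //; exists id.
  have [d dI /orP[/eqP E|cd]] := greedy_cover (equivc g) cI.
    by exists c; rewrite // {1}E.
  exists d => //; rewrite -(isoM c d) ?(greedy_sub dI) // in cd.
  by apply/asboolP; apply: brace_iso_trans (asboolW BMc) (asboolW cd).
Qed.
End Count.

Theorem mainTheorem4 (p : nat) (p_pr : prime p) (p_ge7 : 7 <= p) :
  [/\ p = 11 %[mod 12] -> num_left_braces (12 * p) = 24,
      p = 5 %[mod 12] -> num_left_braces (12 * p) = 28,
      p = 7 %[mod 12] -> num_left_braces (12 * p) = 34
    & p = 1 %[mod 12] -> num_left_braces (12 * p) = 40].
Proof.
(* The exponent g = gcd(12, p - 1) depends only on p modulo 12. *)
have gcdE r : p = r.+1 %[mod 12] -> gcdn 12 p.-1 = gcdn 12 r.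
  move=> pr; rewrite -[LHS]gcdn_modr -[RHS]gcdn_modr; congr gcdn.
  by apply/eqP; rewrite -(eqn_modDl 1) !add1n prednK ?prime_gt0 // pr.
rewrite !(num_left_braces_reps p_pr p_ge7).
split=> /gcdE ->; vm_compute; reflexivity.
Qed.
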